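(* If $G$ is a path of even length or a cycle of even length, then the starting position of $2$-distance $2$-coloring on $G$ is a $\mathcal{P}$-position.
   Context: The length of a path or cycle is its number of vertices. $2$-distance $2$-coloring is the following impartial game on an undirected graph $G$: two players alternate; a move chooses one uncolored vertex and assigns it one of two colors so that no two distinct vertices at (edge-)distance at most $2$ in $G$ have the same color. Both players may use both colors. Colored vertices are never recolored. The player unable to move loses. The starting position is the one with all vertices uncolored. A position is a $\mathcal{P}$-position if the second player (the one not about to move) has a winning strategy, and an $\mathcal{N}$-position otherwise. *)

(* Defs.v *)
From mathcomp Require Import all_boot.

Set Implicit Arguments.
Unset Strict Implicit.
Unset Printing Implicit Defensive.

(* An undirected graph on a finite type T is given by its adjacency relation. *)
Section Graphs.
Variables (T : finType) (e : rel T).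

(* There is a walk with at most d edges from x to y, i.e. the edge-distance
   between x and y is at most d (it is infinite if there is no walk). *)
Definition dist_le (d : nat) (x y : T) : bool :=
  [exists k : 'I_d.+1, [exists p : k.-tuple T, path e x p && (last x p == y)]].

(* In both predicates below the length n counts vertices. *)
Definition is_path_graph (n : nat) : Prop :=
  0 < n /\
  exists f : 'I_n -> T, bijective f /\
    forall i j : 'I_n,
      e (f i) (f j) = (i.+1 == j :> nat) || (j.+1 == i :> nat).

Definition is_cycle_graph (n : nat) : Prop :=
  2 < n /\
  exists f : 'I_n -> T, bijective f /\
    forall i j : 'I_n,
      e (f i) (f j) = (i.+1 %% n == j :> nat) || (j.+1 %% n == i :> nat).

End Graphs.

(* Games given by a type of positions X and a move relation, available to both
   players; the player unable to move loses. *)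
Section Games.
Variables (X : Type) (move : rel X).

(* A strategy receives the positions met so far, oldest first, the last one
   being the current position, and returns the next position. *)
Definition strategy := seq X -> X.

Definition terminal (x : X) : Prop := forall y, ~~ move x y.

Definition legal_strategy (s : strategy) : Prop :=
  forall x h, ~ terminal (last x h) -> move (last x h) (s (x :: h)).

(* A play from x is a sequence p of successive positions; the moves of even
   index are made by the first player, those of odd index by the second. *)
Definition second_follows (s : strategy) (x : X) (p : seq X) : Prop :=
  forall i, i < size p -> odd i -> nth x p i = s (x :: take i p).

(* In a completed play the first player is the one unable to move exactly when
   the number of moves is even. Only finite plays are considered: this is
   adequate for games without infinite plays, such as the one below. *)
Definition winning_for_second (s : strategy) (x : X) : Prop :=
  forall p, path move x p -> second_follows s x p -> terminal (last x p) ->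
    ~~ odd (size p).

Definition P_position (x : X) : Prop :=
  exists s, legal_strategy s /\ winning_for_second s x.

End Games.

Section Coloring.
Variables (T : finType) (e : rel T).

(* None means uncolored; the two colors are the booleans. *)
Definition position := {ffun T -> option bool}.

Definition start : position := [ffun => None].

Definition proper (c : position) : bool :=
  [forall x, forall y,
    [&& x != y, dist_le e 2 x y & c x != None] ==> (c x != c y)].

Definition color (c : position) (v : T) (a : bool) : position :=
  [ffun w => if w == v then Some a else c w].

Definition coloring_move : rel position := fun c c' =>
  [exists v, exists a,
    [&& c v == None, c' == color c v a & proper c']].

End Coloring.

Arguments start {T}.

(* Main.v *)
Require Import Defs.
From mathcomp Require Import all_boot.

(** The second player wins by playing mirror images in the opposite color.

    Paths and cycles on an even number of vertices, numbered from [0] to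
    [n - 1] along the graph, share a symmetry: the reflection sending [i] to
    [n - 1 - i]. It is an involution, and as [n] is even it has no fixed
    vertex. Answering the color [a] on [v] by the color [~~ a] on the mirror
    image of [v] restores after each round a position in which mirror images
    have opposite colors ([mirrored]).

    Such an answer is always legal ([mirror_reply]). The mirror image of [v] is
    still uncolored, since [v] was and the two are distinct. The two vertices
    of the round may be at distance at most 2, but they get different colors,
    so they do not conflict; and a conflict of the answer with an older vertex
    [w] would be the mirror image of a conflict of [v] with the mirror image of
    [w], which the legality of the first player's move excludes. Opposite
    colors are essential here: with equal ones, the answer to a move on one of
    the two middle vertices of a path would be illegal.

    Hence the second player is never the one who is stuck
    ([P_position_invariant]). The argument applies to every graph with an
    involutive automorphism without fixed vertices
    ([P_position_fixfree_involution]). *)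

(** If the second player can always return to [S], then every completed play
    has even length: after an odd number of moves the position was reached by
    a move out of [S], so a reply exists and the play is not over. *)
Lemma P_position_invariant (X : finType) (move : rel X) (S : pred X) (x : X) :
    S x ->
    (forall y z, S y -> move y z -> exists2 t, move z t & S t) ->
  P_position move x.
Proof.
move=> Sx reply.
(* The inner choice serves only the positions from which [S] is out of reach,
   where a strategy must still move legally whenever possible. *)
pose g y := odflt (odflt y [pick z | move y z]) [pick z | move y z && S z].
have gS y z : S y -> move y z -> S (g z).
  move=> Sy /(reply _ _ Sy) [t mzt St]; rewrite /g.
  case: [pick u | move z u & S u] / pickP => [u|noS] /=.
    by case/andP.
  by have := noS t; rewrite mzt St.
pose s h := g (last x h).
exists s; split.
  move=> y h nterm; rewrite /s /g /=.
  case: [pick u | move _ u & S u] / pickP => [u /andP[] //|_] /=.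
  by case: pickP => [//|no]; case: nterm => u; rewrite no.
have win m y p : size p < m -> S y -> path move y p ->
    second_follows s y p -> terminal move (last y p) -> ~~ odd (size p).
  elim: m y p => // m IHm y [|z [|t p]] //=.
    move=> _ Sy /andP[myz _] _ term.
    by have [t mzt _] := reply _ _ Sy myz; move/negP: (term t).
  move=> lt_p Sy /and3P[myz mzt pth] follow term; rewrite negbK.
  have def_t : t = g z by have /= := follow 1 isT isT.
  apply: (IHm t) => //; first exact: ltnW.
    by rewrite def_t; apply: gS Sy myz.
  move=> i lt_ip odd_i.
  have /= := follow i.+2 lt_ip; rewrite negbK => /(_ odd_i).
  by rewrite (set_nth_default t) // => ->.
by move=> p pth; apply: (win (size p).+1 x p).
Qed.

Section FixfreeInvolution.

Variables (T : finType) (e : rel T) (h : T -> T).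
Hypothesis (hK : involutive h) (h_fixfree : forall v, h v != v).
Hypothesis (h_auto : forall v w, e (h v) (h w) = e v w).

Lemma dist_le_auto d v w : dist_le e d v w -> dist_le e d (h v) (h w).
Proof.
case/existsP=> k /existsP[p /andP[pth /eqP <-]].
apply/existsP; exists k; apply/existsP; exists (map_tuple h p).
rewrite /= last_map eqxx andbT path_map.
by rewrite (eq_path (e' := e)).
Qed.

Definition mirrored (c : position T) : bool :=
  [forall v, c (h v) == omap negb (c v)].

Lemma mirrored_start : mirrored start.
Proof. by apply/forallP=> v; rewrite !ffunE. Qed.

(** The reply is at [h v] with the opposite color. Older vertices do not block
    it: one at distance at most 2 from [h v] with color [~~ a] would have a
    mirror image at distance at most 2 from [v] with color [a]. *)
Lemma mirror_reply c c' : mirrored c -> coloring_move e c c' ->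
  exists2 c'', coloring_move e c' c'' & mirrored c''.
Proof.
move=> /forallP mc /existsP[v /existsP[a /and3P[/eqP cv /eqP-> prop]]].
have cM w : c (h w) = omap negb (c w) by apply/eqP.
have conflict x y : x != y -> dist_le e 2 x y ->
    color c v a x != None -> color c v a x != color c v a y.
  move=> xy dxy cx; move/forallP/(_ x)/forallP/(_ y)/implyP: prop.
  by apply; rewrite xy dxy.
have hv w : (w == h v) = (h w == v) by rewrite -(inj_eq (inv_inj hK)) hK.
exists (color (color c v a) (h v) (~~ a)); last first.
  apply/forallP=> w; rewrite !ffunE (inj_eq (inv_inj hK)) -hv.
  have [->|wv] := eqVneq w v; first by rewrite [v == h v]eq_sym (negbTE (h_fixfree v)).
  by have [_|_] := eqVneq w (h v); rewrite /= ?negbK // cM.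
apply/existsP; exists (h v); apply/existsP; exists (~~ a).
rewrite eqxx /= !ffunE (negbTE (h_fixfree v)) cM cv /=.
apply/forallP=> x; apply/forallP=> y; apply/implyP=> /and3P[xy dxy].
rewrite [color (color _ _ _) _ _ x]ffunE [color (color _ _ _) _ _ y]ffunE.
(* If the answer is at [x] or [y], the pair is reflected by [h], so that
   [conflict] speaks of [v] and of the image of the other vertex. *)
have [xhv|xhv] := eqVneq x (h v); have [yhv|yhv] := eqVneq y (h v).
- by rewrite xhv yhv eqxx in xy.
- move=> _; have := conflict (h x) (h y).
  rewrite (inj_eq (inv_inj hK)) => /(_ xy (dist_le_auto _ _ _ dxy)).
  rewrite !ffunE -!hv xhv eqxx (negbTE yhv) cM => /(_ isT).
  have [_|_] := eqVneq y v; first by case: (a).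
  by case: (c y) => [[]|]; case: (a).
- have := conflict (h x) (h y).
  rewrite (inj_eq (inv_inj hK)) => /(_ xy (dist_le_auto _ _ _ dxy)).
  rewrite !ffunE -!hv yhv eqxx (negbTE xhv) cM.
  have [_|_] := eqVneq x v; first by case: (a).
  by case: (c x) => [b|] //= /(_ isT); case: b; case: (a).
- exact: conflict.
Qed.

Lemma P_position_fixfree_involution : P_position (coloring_move e) start.
Proof. exact: P_position_invariant mirrored_start mirror_reply. Qed.

End FixfreeInvolution.

(** Transport of the reflection [rev_ord] along a numbering of the vertices. A
    fixed vertex would have number [i] with [n = i + (i + 1)]. *)
Lemma P_position_reversible {T : finType} {e : rel T} {n : nat}
    (f : 'I_n -> T) : bijective f -> ~~ odd n ->
    (forall i j, e (f (rev_ord i)) (f (rev_ord j)) = e (f i) (f j)) ->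
  P_position (coloring_move e) start.
Proof.
case=> g fK gK even_n f_rev.
apply: (@P_position_fixfree_involution _ _ (fun v => f (rev_ord (g v)))).
- by move=> v; rewrite fK rev_ordK gK.
- move=> v; rewrite -{2}[v]gK (inj_eq (can_inj fK)).
  apply: contra even_n => /eqP/(congr1 val) /= rev_gv.
  by rewrite -(subnK (ltn_ord (g v))) rev_gv addnS /= oddD addbb.
- by move=> v w; rewrite f_rev !gK.
Qed.

Lemma path_succ_rev n (i j : 'I_n) :
  ((rev_ord i).+1 == rev_ord j) = (j.+1 == i).
Proof.
by rewrite /= -subSn // subSS -(eqn_add2r j.+1) subnK // -(eqn_add2l i) addnA
           subnKC 1?ltnW // addnC eqn_add2r.
Qed.

Lemma modn_succ_ord n (i j : 'I_n) :
  (i.+1 %% n == j) = (i.+1 == j) || (i.+1 == n) && (j == 0 :> nat).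
Proof.
have [->|i_neq] := eqVneq i.+1 n.
  by rewrite modnn eq_sym (gtn_eqF (ltn_ord j)).
by rewrite modn_small ?orbF // ltn_neqAle i_neq ltn_ord.
Qed.

(** Besides the edges of the path there is the closing edge, which is preserved
    since the reflection exchanges the two ends of the numbering. *)
Lemma cycle_succ_rev n (i j : 'I_n) :
  ((rev_ord i).+1 %% n == rev_ord j) = (j.+1 %% n == i).
Proof.
rewrite !modn_succ_ord path_succ_rev /= -subSn // subSS subn_eq0 andbC.
rewrite [_ <= _.+1]leqNgt ltn_neqAle ltn_ord andbT negbK.
congr (_ || (_ && _)).
by rewrite -(eqn_add2r i) subnK 1?ltnW // -{1}[n]addn0 eqn_add2l eq_sym.
Qed.

Theorem theorem16 (T : finType) (e : rel T) (n : nat)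
    (hG : is_path_graph e n \/ is_cycle_graph e n) (hn : ~~ odd n) :
  P_position (coloring_move e) start.
Proof.
case: hG => [[_ [f [f_bij f_adj]]]|[_ [f [f_bij f_adj]]]].
  apply: (P_position_reversible f) => // i j.
  by rewrite !f_adj !path_succ_rev orbC.
apply: (P_position_reversible f) => // i j.
by rewrite !f_adj !cycle_succ_rev orbC.
Qed.
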